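(* For every $\varepsilon>0$ and every $\alpha<1$ there exist $\delta>0$ and $K>0$ such that the following holds. Let $G$ be a connected graph on vertex set $[n]$, let $R\sim G(n,\varepsilon/n)$ and $G^*=G\cup R$. Then asymptotically almost surely, for every set $S\subseteq[n]$ that induces a connected subgraph of $G^*$ and satisfies $K\log n\le |S|\le \alpha n$, we have $|\partial_{G^*}S|\ge \delta|S|$.
   Context: $G(n,p)$ denotes the binomial random graph on $[n]$ with each pair an edge independently with probability $p$; $G\cup R$ is the graph on $[n]$ with edge set the union of those of $G$ and $R$. For a graph $H$ and a vertex set $S$, $\partial_H S$ is the set of edges of $H$ with exactly one endpoint in $S$. Asymptotically almost surely means with probability tending to $1$ as $n\to\infty$, for an arbitrary sequence of such graphs $G=G_n$. *)

(* Defs.v *)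
From mathcomp Require Import all_boot.
From Stdlib Require Import Reals.

Set Implicit Arguments.
Unset Strict Implicit.
Unset Printing Implicit Defensive.

(* A (simple) graph on [n] = 'I_n is a set of 2-element subsets of 'I_n. *)
Definition pairs (n : nat) : {set {set 'I_n}} := [set e : {set 'I_n} | #|e| == 2].

Definition adj (n : nat) (E : {set {set 'I_n}}) : rel 'I_n :=
  fun x y => (x != y) && ([set x; y] \in E).

Definition connectedb (n : nat) (E : {set {set 'I_n}}) : bool :=
  [forall x, forall y, connect (adj E) x y].

Definition induced_connected (n : nat) (E : {set {set 'I_n}}) (S : {set 'I_n}) : bool :=
  [forall x in S, forall y in S,
     connect (fun u v => [&& u \in S, v \in S & adj E u v]) x y].

Definition boundary (n : nat) (E : {set {set 'I_n}}) (S : {set 'I_n}) : {set {set 'I_n}} :=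
  [set e in E | #|e :&: S| == 1].

Definition gunion (n : nat) (E F : {set {set 'I_n}}) : {set {set 'I_n}} := E :|: F.

Definition Rleb (x y : R) : bool := if Rle_dec x y then true else false.

Definition gnp_weight (n : nat) (p : R) (E : {set {set 'I_n}}) : R :=
  (p ^ #|E| * (1 - p) ^ (#|pairs n| - #|E|)%nat)%R.

Definition gnp_prob (n : nat) (p : R) (A : pred {set {set 'I_n}}) : R :=
  \big[Rplus/0%R]_(E : {set {set 'I_n}} | (E \subset pairs n) && A E) gnp_weight p E.

Definition expansion_event (n : nat) (G : {set {set 'I_n}}) (delta K alpha : R)
    (Rg : {set {set 'I_n}}) : bool :=
  let Gs := gunion G Rg in
  [forall S : {set 'I_n},
     [&& induced_connected Gs S,
         Rleb (K * ln (INR n)) (INR #|S|) &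
         Rleb (INR #|S|) (alpha * INR n)]
     ==> Rleb (delta * INR #|S|) (INR #|boundary Gs S|)].

(* Main.v *)
(* Fix a set S with |S| = s that is connected in G \cup R but has fewer than delta s boundary
   edges. A set F of at most |\partial_G S| edges of R already makes S connected together
   with G[S], so the probability that S is bad is at most the sum over F of (eps/n)^|F|
   times the probability that few of the s(n - s) crossing pairs are open, which is e^{-cs}
   up to a factor e^{O(delta s)}.

   To sum over all pairs (S, F) with a given v in S, compare with a much sparser percolation:
   delete each vertex with a small probability q, keep the edges of G between surviving
   vertices, and open each pair with probability eta/n. If N_G(S) is deleted, S survives,
   and F is exactly the set of open pairs touching S, then S is the component of v. These
   events are therefore disjoint, and each has probability at least (1-q)^s q^{delta s}
   (eta/n)^|F| e^{-2 eta s}. So the sum over (S, F) of the bad probabilities is at most the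
   largest ratio of the two bounds, which is e^{-cs/4} <= n^{-2} for s >= K log n; summing
   over v leaves 1/n. *)

Require Import Defs.
From mathcomp Require Import all_boot all_order all_algebra.
From mathcomp Require Import Rstruct.
From Stdlib Require Import Reals ZArith Lra Lia.

Set Implicit Arguments.
Unset Strict Implicit.
Unset Printing Implicit Defensive.

(** * Boundaries, pair counts and sparse connectors *)

Definition outer_neighbours (n : nat) (E : {set {set 'I_n}}) (S : {set 'I_n}) : {set 'I_n} :=
  [set y | (y \notin S) && [exists x in S, adj E x y]].

Definition touching (n : nat) (S : {set 'I_n}) : {set {set 'I_n}} :=
  [set e in pairs n | ~~ [disjoint e & S]].

Definition within (n : nat) (S : {set 'I_n}) (r : rel 'I_n) : rel 'I_n :=
  fun u v => [&& u \in S, v \in S & r u v].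

(** [D] is the set of deleted vertices. Deletion only kills edges of [G]; a pair of [E] stays open
    even at a deleted vertex. *)
Definition site_bond (n : nat) (G : {set {set 'I_n}}) (D : {set 'I_n}) (E : {set {set 'I_n}}) :
    rel 'I_n :=
  fun x y => [&& x \notin D, y \notin D & adj G x y] || adj E x y.

Lemma adj_sym (n : nat) (E : {set {set 'I_n}}) : symmetric (adj E).
Proof. by move=> x y; rewrite /adj eq_sym setUC. Qed.

Lemma adjU (n : nat) (E F : {set {set 'I_n}}) x y :
  adj (gunion E F) x y = adj E x y || adj F x y.
Proof. by rewrite /adj /gunion inE -andb_orr. Qed.

Lemma pair_in_pairs (n : nat) (x y : 'I_n) : x != y -> [set x; y] \in pairs n.
Proof. by move=> xy; rewrite inE cards2 xy. Qed.

Lemma boundary_cross (n : nat) (E : {set {set 'I_n}}) (S : {set 'I_n}) x y :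
  [set x; y] \in E -> x \in S -> y \notin S -> [set x; y] \in boundary E S.
Proof.
move=> Exy xS yS; rewrite inE Exy /=.
suff -> : [set x; y] :&: S = [set x] by rewrite cards1.
apply/setP=> z; rewrite !inE; case: (eqVneq z x) => [->|zx] //=.
by case: (eqVneq z y) => [->|//]; rewrite (negbTE yS).
Qed.

Lemma boundary_mono (n : nat) (E F : {set {set 'I_n}}) (S : {set 'I_n}) :
  E \subset F -> boundary E S \subset boundary F S.
Proof.
by move=> sEF; apply/subsetP=> e; rewrite !inE => /andP[/(subsetP sEF) -> ->].
Qed.

Lemma connect_exit (T : finType) (r : rel T) (A : {set T}) x y :
  connect r x y -> x \in A -> y \notin A -> exists a b, [/\ a \in A, b \notin A & r a b].
Proof.
move=> cxy xA yA.
case: (boolP [exists a in A, [exists b, (b \notin A) && r a b]]).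
  by case/exists_inP=> a aA /existsP[b /andP[bA rab]]; exists a, b.
move/exists_inPn=> noexit; case/negP: yA.
have [p pp ->] := connectP cxy.
elim: p x xA pp {cxy y} => //= z p IHp x xA /andP[rxz pp].
apply: IHp pp; apply/negPn/negP=> zA.
by move/existsPn: (noexit x xA) => /(_ z); rewrite zA rxz.
Qed.

(** Each outer neighbour is the end outside [S] of some edge of [G] leaving [S], so mapping edges to
    outer ends covers all of them. *)
Lemma card_outer_neighbours (n : nat) (G : {set {set 'I_n}}) (S : {set 'I_n}) :
  #|outer_neighbours G S| <= #|boundary G S|.
Proof.
case: (set_0Vmem (outer_neighbours G S)) => [->|[y0 _]]; first by rewrite cards0.
pose f (e : {set 'I_n}) := odflt y0 [pick y in e :\: S].
apply: leq_trans (leq_imset_card f _); apply/subset_leq_card/subsetP=> y.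
rewrite inE => /andP[yS /exists_inP[x xS /andP[xy Gxy]]].
apply/imsetP; exists [set x; y]; first exact: boundary_cross.
rewrite /f; case: pickP => [z|/(_ y)] /=; rewrite !inE ?eqxx ?orbT ?yS //.
by case/andP=> zS /orP[/eqP zx|/eqP ->//]; rewrite zx xS in zS.
Qed.

Lemma card_touching (n : nat) (S : {set 'I_n}) : #|touching S| <= #|S| * n.
Proof.
rewrite -[X in _ * X]card_ord -cardsT -cardsX.
apply: leq_trans (leq_imset_card (fun u : 'I_n * 'I_n => [set u.1; u.2]) _).
apply/subset_leq_card/subsetP=> e; rewrite !inE => /andP[/cards2P[x [y [xy ->]]]].
move=> /pred0Pn[z /andP[/=]]; rewrite !inE => /orP[]/eqP-> zS; apply/imsetP.
  by exists (x, y); rewrite // !inE zS.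
by exists (y, x); rewrite /= 1?setUC // !inE zS.
Qed.

Lemma card_crossing_pairs (n : nat) (S : {set 'I_n}) :
  #|S| * (n - #|S|) <= #|boundary (pairs n) S|.
Proof.
have -> : n - #|S| = #|~: S| by rewrite [in RHS]cardsCs setCK card_ord.
rewrite -cardsX -(card_in_imset (f := fun u : 'I_n * 'I_n => [set u.1; u.2])).
  apply/subset_leq_card/subsetP=> e /imsetP[[x y]]; rewrite in_setX in_setC => /andP[/= xS yS] ->.
  apply: boundary_cross => //; apply: pair_in_pairs.
  by apply: contraNneq yS => <-.
move=> [x y] [x' y']; rewrite !inE => /andP[/= xS yS] /andP[/= xS' yS'] exy.
have : x \in [set x'; y'] by rewrite -exy !inE eqxx.
have : y \in [set x'; y'] by rewrite -exy !inE eqxx orbT.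
rewrite !inE => /orP[]/eqP ey /orP[]/eqP ex.
- by rewrite ey xS' in yS.
- by rewrite ey xS' in yS.
- by rewrite ex ey.
by rewrite ex (negbTE yS') in xS.
Qed.

(* Grow the part of S reached from v by adding one edge of E at a time: each step absorbs a new
   component of G[S], which has its own edge of G leaving S because G is connected. *)
Lemma sparse_connector (n : nat) (G E : {set {set 'I_n}}) (S : {set 'I_n}) :
  connectedb G -> E \subset pairs n -> S != setT -> induced_connected (gunion G E) S ->
  exists F : {set {set 'I_n}},
    [/\ F \subset E, F \subset powerset S, #|F| <= #|boundary G S| &
        induced_connected (gunion G F) S].
Proof.
move=> Gc Epairs ST Sc.
have [S0|[v vS]] := set_0Vmem S.
  exists set0; split; rewrite ?sub0set ?cards0 //.
  by apply/forall_inP=> x; rewrite S0 inE.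
pose reach (F : {set {set 'I_n}}) :=
  [set x | connect (within S (adj (gunion G F))) v x].
pose leaving (A : {set 'I_n}) := [set e in boundary G S | ~~ [disjoint e & A]].
(* The edges of [F] are paid for by edges of [G] that leave [S] from the part already reached. *)
pose P (F : {set {set 'I_n}}) :=
  [&& F \subset E, F \subset powerset S & #|F| <= #|leaving (reach F)|].
have P0 : P set0 by rewrite /P !sub0set cards0.
have wsym F : connect_sym (within S (adj (gunion G F))).
  by apply: sym_connect_sym => x y; rewrite /within adj_sym andbCA.
have reach_S F : reach F \subset S.
  apply/subsetP=> x; rewrite inE => /connectP[p pp ->].
  elim/last_ind: p pp => [//|p z _]; rewrite rcons_path last_rcons.
  by case/andP=> _ /and3P[].
have reach_step F x y : x \in reach F -> y \in S -> adj (gunion G F) x y -> y \in reach F.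
  move=> xr yS xy; have xS := subsetP (reach_S F) x xr; move: xr; rewrite !inE => cx.
  by apply: connect_trans cx (connect1 _); rewrite /within xS yS.
have v_reach F : v \in reach F by rewrite inE connect0.
(* Unless the largest reach is all of [S], one more edge will contradict maximality. *)
pose F := [arg max_(F > set0 | P F) #|reach F|].
have [PF Fmax] : P F /\ forall F', P F' -> #|reach F'| <= #|reach F|.
  by rewrite /F; case: arg_maxnP => // F1 PF1 m; split.
case/and3P: (PF) => FE FS Fb.
have [rS|rS] := eqVneq (reach F) S.
  exists F; split=> //.
    by apply: leq_trans Fb (subset_leq_card _); apply/subsetP=> e; rewrite inE => /andP[].
  apply/forall_inP=> x xS; apply/forall_inP=> y yS.
  have : x \in reach F by rewrite rS.
  have : y \in reach F by rewrite rS.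
  rewrite !inE => vy vx.
  by apply: connect_trans vy; rewrite (wsym F) in vx.
have [w wS wr] : exists2 w, w \in S & w \notin reach F.
  apply/subsetPn; apply: contra rS => sub.
  by rewrite eqEsubset reach_S.
have /forall_inP/(_ v vS)/forall_inP/(_ w wS) cvw := Sc.
have [a [b [ar br /and3P[aS bS ab]]]] := connect_exit cvw (v_reach F) wr.
(* An edge of [G] would already have extended the reach, so this exit uses an edge of [E]. *)
have Eab : adj E a b.
  move: ab; rewrite adjU => /orP[Gab|//].
  by case/negP: br; apply: reach_step ar bS _; rewrite adjU Gab.
have [neab eE] := andP Eab.
pose F' := [set a; b] |: F.
have sub_reach : reach F \subset reach F'.
  apply/subsetP=> x; rewrite !inE; apply: connect_sub => u z /and3P[uS zS uz].
  apply: connect1; rewrite /within uS zS /=; move: uz; rewrite !adjU => /orP[->//|].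
  by rewrite /adj => /andP[-> uzF]; rewrite /= uzF !orbT.
have br' : b \in reach F'.
  apply: (reach_step F' a) => //; first exact: (subsetP sub_reach).
  by rewrite adjU /adj neab /F' in_setU inE eqxx orbT.
have [z zT] : exists z, z \notin S.
  apply/existsP; rewrite -negb_forall; apply: contra ST => /forallP al.
  by apply/eqP/setP=> x; rewrite al inE.
have /forallP/(_ b)/forallP/(_ z) cbz := Gc.
(* [G] joins [b] to a vertex outside [S], so one of its edges leaves the newly reached piece. That
   edge also leaves [S]: an end [y] in [S] would lie in the old reach and put [x] there too. *)
have [||x [y [xC yC Gxy]]] := @connect_exit _ _ (reach F' :\: reach F) _ _ cbz.
- by rewrite in_setD br br'.
- by rewrite in_setD negb_and; apply/orP; right; apply: contra zT; apply: (subsetP (reach_S F')).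
case/setDP: xC => xr' xr.
have yS : y \notin S.
  apply/negP=> yS.
  have yr' : y \in reach F' by apply: reach_step xr' yS _; rewrite adjU Gxy.
  have yr : y \in reach F by move: yC; rewrite in_setD yr' andbT negbK.
  case/negP: xr; apply: reach_step yr _ _; first exact: (subsetP (reach_S F')).
  by rewrite adjU adj_sym Gxy.
have xS := subsetP (reach_S F') x xr'.
have PF' : P F'.
  apply/and3P; split.
  - by rewrite subUset sub1set eE.
  - rewrite subUset FS andbT sub1set powersetE.
    by apply/subsetP=> u; rewrite !inE => /orP[]/eqP->.
  - apply: leq_trans (_ : #|F|.+1 <= _).
      by rewrite cardsU1; case: (_ \notin _).
    apply: leq_ltn_trans Fb _; apply: proper_card; apply/properP; split.
      apply/subsetP=> e; rewrite !inE => /andP[->] /=; apply: contra.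
      by apply: disjointWr.
    case/andP: Gxy => _ Gxy.
    (* This edge meets the new reach but not the old one, so the number of leaving edges strictly
       grows. *)
    exists [set x; y]; rewrite inE boundary_cross //=.
      by apply/pred0Pn; exists x; rewrite /= xr' !inE eqxx.
    rewrite negbK; apply/pred0P=> u /=; apply/negP=> /andP[].
    rewrite in_set2 => /orP[]/eqP->; first by rewrite (negbTE xr).
    by move/(subsetP (reach_S F)); rewrite (negbTE yS).
have := Fmax _ PF'; rewrite leqNgt; case/negP.
apply: proper_card; apply/properP; split=> //; by exists b.
Qed.

(** * Components of the site-bond percolation *)

(** [S] is held together by [F] and the surviving edges of [G]. Nothing leaves it: edges of [G]
    leaving [S] end in [D], and an open pair touching [S] belongs to [F], hence lies inside [S]. *)
Lemma site_bond_component (n : nat) (G E F : {set {set 'I_n}}) (D S : {set 'I_n}) v :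
  v \in S -> F \subset powerset S -> induced_connected (gunion G F) S ->
  outer_neighbours G S \subset D -> D :&: S = set0 ->
  F \subset E -> E :&: (touching S :\: F) = set0 ->
  S = [set x | connect (site_bond G D E) v x].
Proof.
move=> vS FS Sc ND DS FE Eout.
have SD x : x \in S -> x \notin D.
  by move=> xS; apply/negP=> xD; move/setP: DS => /(_ x); rewrite !inE xD xS.
apply/setP=> x; rewrite inE; apply/idP/idP=> [xS|].
  have /forall_inP/(_ v vS)/forall_inP/(_ x xS) := Sc.
  apply: connect_sub => u w /and3P[uS wS]; rewrite adjU => uw; apply: connect1.
  rewrite /site_bond !SD //=; case/orP: uw => [->//|].
  by rewrite /adj => /andP[-> /(subsetP FE) ->]; rewrite orbT.
move=> cvx; apply/negPn/negP=> xS.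
have [a [b [aS bS]]] := connect_exit cvx vS xS.
case/orP=> [/and3P[_ bD Gab]|/andP[ab Eab]].
  case/negP: bD; apply: (subsetP ND); rewrite inE bS.
  by apply/exists_inP; exists a.
case: (boolP ([set a; b] \in F)) => [/(subsetP FS)|abF].
  by rewrite powersetE => /subsetP/(_ b); rewrite !inE eqxx orbT => /(_ isT); apply/negP.
have : [set a; b] \in E :&: (touching S :\: F).
  rewrite in_setI Eab in_setD abF inE pair_in_pairs //=.
  by apply/pred0Pn; exists a; rewrite /= aS !inE eqxx.
by rewrite Eout inE.
Qed.

(** * Product weights of random subsets *)

Section Weights.

Import Order.TTheory GRing.Theory Num.Theory.
Local Open Scope ring_scope.

(** The law of a random subset of [A] that keeps each element independently with probability [p]; it
    serves both for deleted vertices and for open pairs. *)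
Definition subset_weight (R : realFieldType) (T : finType) (A : {set T}) (p : R)
    (E : {set T}) : R :=
  p ^+ #|E| * (1 - p) ^+ (#|A| - #|E|).

Lemma subset_weight_ge0 (R : realFieldType) (T : finType) (A : {set T}) (p : R) (E : {set T}) :
  0 <= p <= 1 -> 0 <= subset_weight A p E.
Proof. by case/andP=> p0 p1; rewrite mulr_ge0 ?exprn_ge0 // subr_ge0. Qed.

Lemma prod_if_exp (R : realFieldType) (T : finType) (A : {set T}) (x : R) :
  \prod_(i : T) (if i \in A then x else 1) = x ^+ #|A|.
Proof. by rewrite -big_mkcond /= prodr_const. Qed.

(* With z = 0 the factor z ^+ #|E :&: C| is the indicator of E :&: C = set0. *)
Lemma subset_weight_tilt (R : realFieldType) (T : finType) (A X C : {set T}) (p z : R) :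
  X \subset A -> C \subset A -> [disjoint X & C] ->
  \sum_(E : {set T} | (E \subset A) && (X \subset E)) subset_weight A p E * z ^+ #|E :&: C| =
  p ^+ #|X| * (1 - p + p * z) ^+ #|C|.
Proof.
move=> XA CA XC.
(* [a i] and [b i] are the factors of a point inside and outside [E]. Their zeros enforce
   [E \subset A] and [X \subset E], so the sum can range over all [E] and factor. *)
pose a i : R := (if i \in A then p else 0) * (if i \in C then z else 1).
pose b i : R := (if i \in A then 1 - p else 1) * (if i \in X then 0 else 1).
transitivity (\sum_(E in {set T}) \prod_i (if i \in E then a i else b i)).
  rewrite big_mkcond /=; apply: eq_bigr => E _.
  case: ifPn => [/andP[EA XE]|].
    rewrite /subset_weight -cardsDS // -!prod_if_exp -!big_split /=.
    apply: eq_bigr => i _; rewrite /a /b !inE.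
    case: (boolP (i \in E)) => iE; first by rewrite (subsetP EA) //= mulr1.
    have /negbTE-> : i \notin X by apply: contra iE; apply: (subsetP XE).
    by rewrite !mulr1 mul1r.
  rewrite negb_and => /orP[] /subsetPn[i].
    by move=> iE iA; rewrite (bigD1 i) //= iE /a (negbTE iA) !mul0r.
  by move=> iX iE; rewrite (bigD1 i) //= (negbTE iE) /b iX mulr0 mul0r.
rewrite -(bigA_distr _ _ a b) -!prod_if_exp -big_split /=.
apply: eq_bigr => i _; rewrite /a /b.
case: (boolP (i \in X)) => iX.
  by rewrite (subsetP XA) // (disjointFr XC iX) mulr0 addr0.
case: (boolP (i \in C)) => iC; first by rewrite (subsetP CA) // mulr1 mul1r addrC.
by rewrite !mulr1; case: (i \in A); rewrite ?add0r // addrC subrK.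
Qed.

Lemma sum_subset_weight (R : realFieldType) (T : finType) (A : {set T}) (p : R) :
  \sum_(E : {set T} | E \subset A) subset_weight A p E = 1.
Proof.
have := @subset_weight_tilt R T A set0 set0 p 1 (sub0set _) (sub0set _).
rewrite -setI_eq0 set0I cards0 !expr0 mulr1 => /(_ (eqxx _)) <-.
apply: eq_big => E; first by rewrite sub0set andbT.
by rewrite expr1n mulr1.
Qed.

Lemma subset_weight_cylinder (R : realFieldType) (T : finType) (A X C : {set T}) (p : R) :
  X \subset A -> C \subset A -> [disjoint X & C] ->
  \sum_(E : {set T} | [&& E \subset A, X \subset E & E :&: C == set0]) subset_weight A p E =
  p ^+ #|X| * (1 - p) ^+ #|C|.
Proof.
move=> XA CA XC; rewrite -[1 - p]addr0 -[X in 1 - p + X](mulr0 p).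
rewrite -(subset_weight_tilt p 0 XA CA XC).
rewrite [RHS](bigID (fun E => E :&: C == set0)) /= [X in _ = _ + X]big1 ?addr0.
  apply: eq_big => E; first by rewrite andbA.
  by case/and3P=> _ _ /eqP->; rewrite cards0 expr0 mulr1.
by move=> E /andP[_]; rewrite -cards_eq0 expr0n => /negbTE->; rewrite mulr0.
Qed.

(** * Patterns and their disjoint events *)

(** A pattern [(S, F)] is a candidate set with a family of pairs inside it that connects it together
    with [G]. Later [ok] is the size window and [d] the floor of delta |S|. *)
Definition connected_pattern (n : nat) (G : {set {set 'I_n}}) (ok : pred {set 'I_n})
    (d : {set 'I_n} -> nat) (c : {set 'I_n} * {set {set 'I_n}}) : bool :=
  [&& ok c.1, c.2 \subset pairs n, c.2 \subset powerset c.1, (#|c.2| <= d c.1)%nat,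
      (#|boundary G c.1| <= d c.1)%nat & induced_connected (gunion G c.2) c.1].

Definition pattern_event (n : nat) (G : {set {set 'I_n}}) (c : {set 'I_n} * {set {set 'I_n}})
    (D : {set 'I_n}) (E : {set {set 'I_n}}) : bool :=
  [&& outer_neighbours G c.1 \subset D, D :&: c.1 == set0, c.2 \subset E &
      E :&: (touching c.1 :\: c.2) == set0].

(** For [F] a family of pairs, the probability of [pattern_event] when vertices are deleted with
    probability [q] and pairs opened with probability [l], independently. *)
Definition pattern_weight (R : realFieldType) (n : nat) (G : {set {set 'I_n}}) (q l : R)
    (c : {set 'I_n} * {set {set 'I_n}}) : R :=
  q ^+ #|outer_neighbours G c.1| * (1 - q) ^+ #|c.1| *
  (l ^+ #|c.2| * (1 - l) ^+ #|touching c.1 :\: c.2|).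

Lemma touching_sub_pairs (n : nat) (S : {set 'I_n}) : touching S \subset pairs n.
Proof. by apply/subsetP=> e; rewrite inE => /andP[]. Qed.

(** The configuration determines the pattern: [S] is the component of [v], and then [F] is the set
    of open pairs touching [S]. *)
Lemma pattern_event_inj (n : nat) (G : {set {set 'I_n}}) ok d c c' (D : {set 'I_n}) E v :
  connected_pattern G ok d c -> connected_pattern G ok d c' ->
  v \in c.1 -> v \in c'.1 -> pattern_event G c D E -> pattern_event G c' D E -> c = c'.
Proof.
case: c c' => [S F] [S' F'] /andP[/= _ /and5P[Fp FS _ _ Sc]].
move=> /andP[/= _ /and5P[Fp' FS' _ _ Sc']] vS vS'.
case/and4P=> /= ND /eqP DS FE /eqP EF /and4P[/= ND' /eqP DS' FE' /eqP EF'].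
have eS : S = S'.
  rewrite (site_bond_component vS FS Sc ND DS FE EF).
  by rewrite [RHS](site_bond_component vS' FS' Sc' ND' DS' FE' EF').
rewrite -{S' vS' ND' DS' Sc'}eS in FS' EF' *.
suff touch : forall F1 : {set {set 'I_n}},
    F1 \subset pairs n -> F1 \subset powerset S -> F1 \subset E ->
    E :&: (touching S :\: F1) = set0 -> F1 = E :&: touching S.
  by rewrite (touch F) // (touch F').
move=> F1 F1p F1S F1E EF1; apply/setP=> e; rewrite in_setI; apply/idP/andP=> [eF|[eE et]].
  split; first exact: (subsetP F1E).
  rewrite inE (subsetP F1p) //=; have := subsetP F1S e eF; rewrite powersetE => /setIidPl eS.
  by rewrite -setI_eq0 eS -card_gt0; have := subsetP F1p e eF; rewrite inE => /eqP->.
apply/negPn/negP=> eF; have : e \in E :&: (touching S :\: F1) by rewrite !in_setI in_setD eE eF.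
by rewrite EF1 inE.
Qed.

Lemma sum_pattern_weight_le1 (R : realFieldType) (n : nat) (G : {set {set 'I_n}})
    (ok : pred {set 'I_n}) (d : {set 'I_n} -> nat) (q l : R) v :
  0 <= q <= 1 -> 0 <= l <= 1 ->
  \sum_(c | connected_pattern G ok d c && (v \in c.1)) pattern_weight G q l c <= 1.
Proof.
move=> q01 l01.
pose wD := subset_weight [set: 'I_n] q; pose wE := subset_weight (pairs n) l.
have wD0 D : 0 <= wD D by apply: subset_weight_ge0.
have wE0 E : 0 <= wE E by apply: subset_weight_ge0.
have patE c : connected_pattern G ok d c -> pattern_weight G q l c =
    \sum_(D : {set 'I_n}) \sum_(E : {set {set 'I_n}} | E \subset pairs n)
      wD D * wE E * (pattern_event G c D E)%:R.
  case/andP=> _ /and5P[Fp _ _ _ _].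
  rewrite /pattern_weight -(@subset_weight_cylinder _ _ [set: 'I_n]) ?subsetT //; last first.
    by rewrite -setI_eq0; apply/eqP/setP=> x; rewrite !inE; case: (x \in c.1); rewrite ?andbF.
  rewrite -(@subset_weight_cylinder _ _ (pairs n)) //; last 2 first.
  - by apply: subset_trans (subsetDl _ _) (touching_sub_pairs _).
  - by rewrite -setI_eq0; apply/eqP/setP=> x; rewrite !inE; case: (x \in c.2).
  rewrite mulr_suml [LHS]big_mkcond; apply: eq_bigr => D _ /=.
  rewrite subsetT /=; case: ifPn => [/andP[ND DS]|ND].
    rewrite mulr_sumr [LHS]big_mkcond [RHS]big_mkcond; apply: eq_bigr => E _ /=.
    rewrite /pattern_event ND DS /=; case: (E \subset _) => //=.
    by case: ifP; rewrite ?mulr1 ?mulr0.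
  rewrite big1 // => E _; suff /negbTE-> : ~~ pattern_event G c D E by rewrite mulr0.
  by apply: contra ND => /and4P[-> ->].
under eq_bigr => c /andP[cP _] do rewrite patE //.
(* Both sides become sums over [(D, E)], compared term by term: at most one pattern containing [v]
   occurs in each configuration. *)
rewrite exchange_big /= -[leRHS](sum_subset_weight [set: 'I_n] q).
under [leRHS]eq_bigl => D do rewrite subsetT.
apply: ler_sum => D _; rewrite exchange_big /= -[leRHS]mulr1.
rewrite -[X in _ <= _ * X](sum_subset_weight (pairs n) l) mulr_sumr.
apply: ler_sum => E _; rewrite -mulr_sumr -[leRHS]mulr1; apply: ler_wpM2l; first exact: mulr_ge0.
have [c0 /andP[/andP[c0P vc0] c0e]|none] :=
  pickP (fun c => connected_pattern G ok d c && (v \in c.1) && pattern_event G c D E).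
  rewrite (bigD1 c0) ?c0P //= c0e big1 ?addr0 // => c /andP[/andP[cP vc] ne].
  suff /negbTE-> : ~~ pattern_event G c D E by [].
  by apply: contra ne => ce; apply/eqP; exact: (pattern_event_inj cP c0P vc vc0 ce c0e).
rewrite big1 ?ler01 // => c cP.
by have := none c; rewrite cP /= => ->.
Qed.

(** * First-moment bound over patterns *)

Definition nonexpanding (n : nat) (G : {set {set 'I_n}}) (ok : pred {set 'I_n})
    (d : {set 'I_n} -> nat) (E : {set {set 'I_n}}) : bool :=
  [exists S : {set 'I_n}, [&& ok S, induced_connected (gunion G E) S &
     (#|boundary (gunion G E) S| <= d S)%nat]].

(** A bad set yields a pattern of cost at least 1. The mean cost of a pattern is at most [rho] times
    its percolation weight, and these weights sum to at most 1 for each of the [n] roots [v]. *)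
Lemma nonexpanding_weight_le (R : realFieldType) (n : nat) (G : {set {set 'I_n}})
    (ok : pred {set 'I_n}) (d : {set 'I_n} -> nat)
    (p q l rho : R) :
  connectedb G -> 0 <= p <= 1 -> 0 <= q <= 1 -> 0 <= l <= 1 -> 0 <= rho ->
  (forall S, ok S -> (S != set0) && (S != setT)) ->
  (forall S f, ok S -> (f <= d S)%nat ->
     2 ^+ d S * (p ^+ f * (1 - p / 2) ^+ (#|S| * (n - #|S|))) <=
     rho * (q ^+ d S * (1 - q) ^+ #|S| * (l ^+ f * (1 - l) ^+ (#|S| * n)))) ->
  \sum_(E : {set {set 'I_n}} | (E \subset pairs n) && nonexpanding G ok d E)
     subset_weight (pairs n) p E <= rho * n%:R.
Proof.
move=> Gc p01 q01 l01 rho0 okP okB.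
have w0 E : 0 <= subset_weight (pairs n) p E by apply: subset_weight_ge0.
(* Exponential Markov: this is at least 1 when [F] is open and at most [d S] crossing pairs are
   open, and the base 1/2 gives each crossing pair the mean factor [1 - p / 2]. *)
pose cost (c : {set 'I_n} * {set {set 'I_n}}) (E : {set {set 'I_n}}) : R :=
  2 ^+ d c.1 * (c.2 \subset E)%:R * 2^-1 ^+ #|E :&: boundary (pairs n) c.1|.
have cost0 c E : 0 <= cost c E by rewrite !mulr_ge0 ?exprn_ge0 ?invr_ge0 ?ler0n.
apply: (@le_trans _ _ (\sum_(E : {set {set 'I_n}} | E \subset pairs n) \sum_(v : 'I_n)
   \sum_(c | connected_pattern G ok d c && (v \in c.1)) subset_weight (pairs n) p E * cost c E)).
  rewrite big_mkcondr /=; apply: ler_sum => E Ep; case: ifPn => [|_]; last first.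
    by apply: sumr_ge0 => v _; apply: sumr_ge0 => c _; rewrite mulr_ge0.
  case/existsP=> S /and3P[okS Sc Sb].
  have /andP[S0 ST] := okP S okS.
  have [F [FE FS Fb Fc]] := sparse_connector Gc Ep ST Sc.
  have [v vS] := set0Pn _ S0.
  have bGb : (#|boundary G S| <= d S)%nat.
    apply: leq_trans Sb; apply/subset_leq_card/boundary_mono; exact: subsetUl.
  have patSF : connected_pattern G ok d (S, F).
    rewrite /connected_pattern /= okS FS bGb Fc (leq_trans Fb bGb) !andbT /=.
    exact: subset_trans Ep.
  rewrite (bigD1 v) //= (bigD1 (S, F)) /= ?patSF //.
  apply: (@le_trans _ _ (subset_weight (pairs n) p E * cost (S, F) E)); last first.
    rewrite -[leLHS]addr0 -addrA lerD2l addr_ge0 //.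
      by apply: sumr_ge0 => c _; rewrite mulr_ge0.
    by apply: sumr_ge0 => u _; apply: sumr_ge0 => c _; rewrite mulr_ge0.
  rewrite -[leLHS]mulr1 ler_wpM2l // /cost /= FE mulr1 exprVn.
  rewrite ler_pdivlMr ?exprn_gt0 ?ltr0n // mul1r ler_eXn2l ?ltr1n //.
  apply: leq_trans Sb; apply/subset_leq_card/subsetP=> e.
  by rewrite !inE => /andP[-> /andP[_ ->]]; rewrite orbT.
rewrite exchange_big /=.
apply: (@le_trans _ _ (\sum_(v : 'I_n) rho)); last by rewrite sumr_const card_ord mulr_natr.
apply: ler_sum => v _; rewrite exchange_big /= -[leRHS]mulr1.
apply: le_trans (ler_wpM2l rho0 (sum_pattern_weight_le1 G ok d v q01 l01)).
rewrite mulr_sumr; apply: ler_sum => -[S F] /andP[/= cP _].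
case/andP: (cP) => /= okS /and5P[Fp FS Fd bd _].
(* [F] lies inside [S], so it is independent of the crossing pairs. *)
have disFC : [disjoint F & boundary (pairs n) S].
  apply/pred0P=> e /=; apply/negP=> /andP[eF]; rewrite inE => /andP[ep].
  have := subsetP FS e eF; rewrite powersetE => /setIidPl->.
  by move: ep; rewrite inE => /eqP->.
have Cp : boundary (pairs n) S \subset pairs n by apply/subsetP=> e; rewrite inE => /andP[].
apply: (@le_trans _ _ (2 ^+ d S * (p ^+ #|F| * (1 - p / 2) ^+ #|boundary (pairs n) S|))).
  have -> : 1 - p / 2 = 1 - p + p * 2^-1.
    by rewrite -addrA; congr (_ + _); rewrite {2}[p]splitr opprD subrK.
  rewrite -(subset_weight_tilt p 2^-1 Fp Cp disFC) mulr_sumr big_mkcondr /=.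
  apply: ler_sum => E Ep; rewrite /cost /=; case: (F \subset E); last by rewrite mulr0 mul0r mulr0.
  by rewrite mulr1 mulrCA.
have half01 : 0 <= 1 - p / 2 <= 1.
  case/andP: p01 => p0 p1; rewrite subr_ge0 ler_pdivrMr ?ltr0n // mul1r.
  rewrite (le_trans p1) ?ler1n //= gerBl divr_ge0 ?ler0n //.
apply: (@le_trans _ _ (2 ^+ d S * (p ^+ #|F| * (1 - p / 2) ^+ (#|S| * (n - #|S|))))).
  rewrite ler_wpM2l ?exprn_ge0 // ler_wpM2l ?exprn_ge0 //; first by case/andP: p01.
  by rewrite ler_wiXn2l ?card_crossing_pairs //; case/andP: half01.
apply: le_trans (okB S #|F| okS Fd) _; apply: ler_wpM2l => //; rewrite /pattern_weight /=.
case/andP: q01 => q0 q1; case/andP: l01 => l0 l1.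
have q1' : 0 <= 1 - q by rewrite subr_ge0.
have l1' : 0 <= 1 - l by rewrite subr_ge0.
(* Bases at most 1 allow larger exponents: there are at most [d S] outer neighbours and at most
   [#|S| * n] touching pairs. *)
apply: ler_pM; rewrite ?mulr_ge0 ?exprn_ge0 //.
  apply: ler_wpM2r; rewrite ?exprn_ge0 //; apply: ler_wiXn2l => //.
  exact: leq_trans (card_outer_neighbours G S) bd.
apply: ler_wpM2l; rewrite ?exprn_ge0 //; apply: ler_wiXn2l => //; first by rewrite gerBl.
exact: leq_trans (subset_leq_card (subsetDl _ _)) (card_touching S).
Qed.

End Weights.

(** * Real estimates and the choice of constants *)

Section Estimates.

Local Open Scope R_scope.

Lemma exp_le (x y : R) : x <= y -> exp x <= exp y.
Proof. by case=> [lt|->]; [left; apply: exp_increasing|right]. Qed.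

Lemma exp_pow (x : R) (n : nat) : exp x ^ n = exp (x * INR n).
Proof.
elim: n => [|n IHn]; first by rewrite /= Rmult_0_r exp_0.
by rewrite S_INR /= IHn -exp_plus; f_equal; ring.
Qed.

Lemma pow_one_minus_le (x : R) (n : nat) : 0 <= x <= 1 -> (1 - x) ^ n <= exp (- (x * INR n)).
Proof.
move=> x01; apply: Rle_trans (_ : exp (- x) ^ n <= _).
  by apply: pow_incr; have := exp_ineq1_le (- x); lra.
by rewrite exp_pow; right; f_equal; ring.
Qed.

(** On this range (1 - x) e^{2x} >= (1 - x)(1 + 2x) >= 1. *)
Lemma pow_one_minus_ge (x : R) (n : nat) :
  0 <= x <= / 2 -> exp (- (2 * x * INR n)) <= (1 - x) ^ n.
Proof.
move=> x01.
have -> : - (2 * x * INR n) = (- (2 * x)) * INR n by ring.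
rewrite -exp_pow; apply: pow_incr; split; first by left; apply: exp_pos.
have e1 := exp_ineq1_le (2 * x); have e2 := exp_pos (- (2 * x)).
have e3 : exp (- (2 * x)) * exp (2 * x) = 1 by rewrite -exp_plus Rplus_opp_l exp_0.
nra.
Qed.

Definition nat_floor (x : R) : nat := Z.to_nat (Int_part x).

Lemma nat_floor_le (x : R) : 0 <= x -> INR (nat_floor x) <= x.
Proof.
move=> x0; have [ub lb] := base_Int_part x.
have z0 : (0 <= Int_part x)%Z.
  by apply/Z.lt_succ_r; apply: lt_IZR; rewrite succ_IZR; lra.
by rewrite /nat_floor INR_IZR_INZ Z2Nat.id.
Qed.

Lemma nat_floor_max (x : R) (k : nat) : INR k <= x -> Peano.le k (nat_floor x).
Proof.
move=> kx; have [ub lb] := base_Int_part x.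
have kz : (Z.of_nat k <= Int_part x)%Z.
  by apply/Z.lt_succ_r; apply: lt_IZR; rewrite succ_IZR -INR_IZR_INZ; lra.
rewrite /nat_floor; lia.
Qed.

(** The crossing pairs give e^{-cs}. Three losses of at most e^{cs/4}, from the [d]-th powers, the
    survival of [S] and the closed touching pairs, leave e^{-cs/4}, which is at most n^{-2} by the
    lower bound on [s]. *)
Lemma weight_ratio (eps alpha : R) : 0 < eps -> alpha < 1 ->
  exists q eta delta K : R,
    [/\ 0 < q < 1, 0 < eta, 0 < delta, 0 < K &
    forall n s m d f : nat,
      eps <= INR n -> 2 * eta <= INR n ->
      K * ln (INR n) <= INR s -> INR s <= alpha * INR n -> INR d <= delta * INR s ->
      INR m = INR s * (INR n - INR s) -> Peano.le f d ->
      2 ^ d * ((eps / INR n) ^ f * (1 - eps / INR n / 2) ^ m) <=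
      exp (- (2 * ln (INR n))) *
        (q ^ d * (1 - q) ^ s * ((eta / INR n) ^ f * (1 - eta / INR n) ^ (Nat.mul s n)))].
Proof.
move=> eps0 alpha1.
(* The half comes from the tilt by 1/2, and [1 - alpha] from n - s >= (1 - alpha) n. *)
pose c := eps * (1 - alpha) / 2.
have c0 : 0 < c by rewrite /c; nra.
(* Makes [(1 - q) ^ s] equal to e^{-cs/4}. *)
pose q := 1 - exp (- (c / 4)).
have q01 : 0 < q < 1.
  have := exp_pos (- (c / 4)); have := exp_increasing (- (c / 4)) 0.
  rewrite exp_0 /q; lra.
(* [eta <= c / 8] keeps the factor of the closed pairs above e^{-cs/4}; [eta <= eps] lets
   [(eps / eta) ^ f] be bounded by [(eps / eta) ^ d]. *)
pose eta := Rmin eps (c / 8).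
have eta0 : 0 < eta by apply: Rmin_glb_lt; lra.
have eta_eps : eta <= eps by apply: Rmin_l.
have eta_c : eta <= c / 8 by apply: Rmin_r.
(* [M] collects what is raised to the power [d]: 2 from Markov, [eps / eta] from the pairs of [F],
   [1 / q] from the deleted neighbours. *)
pose M := 2 * (eps / eta) / q.
have r1 : 1 <= eps / eta.
  by apply: (Rmult_le_reg_r eta) => //; rewrite /Rdiv Rmult_assoc Rinv_l; lra.
have M1 : 1 < M.
  rewrite /M; apply: (Rmult_lt_reg_r q); first lra.
  rewrite /Rdiv Rmult_assoc Rinv_l; last lra.
  by rewrite -/(eps / eta); lra.
have lnM : 0 < ln M by rewrite -ln_1; apply: ln_increasing; lra.
(* [delta] ensures [M ^ d <= exp (c * t / 4)] and [K] ensures [2 * ln N <= c * t / 4], with [t] for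
   [INR s]. *)
exists q, eta, (c / (4 * ln M)), (8 / c).
have quot0 x y : 0 < x -> 0 < y -> 0 < x / y by apply: Rdiv_lt_0_compat.
split=> //; [by apply: quot0; lra | by apply: quot0; lra | ].
move=> n s m d f nE nH sK sA dS mE fd.
set N := INR n in nE nH sK sA mE *; set t := INR s in sK sA dS mE *.
have N0 : 0 < N by lra.
have t0 : 0 <= t by apply: pos_INR.
have lnN : 2 * ln N <= c * t / 4.
  have -> : ln N = c / 8 * (8 / c * ln N) by field; lra.
  by have := Rmult_le_compat_l (c / 8) _ _ ltac:(lra) sK; lra.
have pw0 x k : 0 <= x -> 0 <= x ^ k by apply: pow_le.
have epsN : 0 <= eps / N <= 1.
  split; first by left; apply: quot0.
  by apply: (Rmult_le_reg_r N) => //; rewrite /Rdiv Rmult_assoc Rinv_l; lra.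
have etaN : 0 <= eta / N <= / 2.
  split; first by left; apply: quot0.
  by apply: (Rmult_le_reg_r N) => //; rewrite /Rdiv Rmult_assoc Rinv_l; lra.
have cross : (1 - eps / N / 2) ^ m <= exp (- (c * t)).
  apply: Rle_trans (pow_one_minus_le _ _) _; first lra.
  apply: exp_le; apply: Ropp_le_contravar.
  rewrite mE /c.
  have -> : eps / N / 2 * (t * (N - t)) = eps * t / 2 * ((N - t) / N) by field; lra.
  have : 1 - alpha <= (N - t) / N.
    by apply: (Rmult_le_reg_r N) => //; rewrite /Rdiv Rmult_assoc Rinv_l; lra.
  have : 0 <= eps * t / 2 by nra.
  nra.
have Md : M ^ d <= exp (c * t / 4).
  have -> : M = exp (ln M) by rewrite exp_ln //; lra.
  rewrite exp_pow; apply: exp_le.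
  have -> : c * t / 4 = ln M * (c / (4 * ln M) * t) by field; lra.
  by apply: Rmult_le_compat_l => //; lra.
have qs : (1 - q) ^ s = exp (- (c * t / 4)).
  have -> : 1 - q = exp (- (c / 4)) by rewrite /q; ring.
  by rewrite exp_pow -/t; f_equal; field.
have etasn : exp (- (c * t / 4)) <= (1 - eta / N) ^ (Nat.mul s n).
  apply: Rle_trans (pow_one_minus_ge _ etaN); apply: exp_le; apply: Ropp_le_contravar.
  rewrite mult_INR -/N -/t.
  have -> : 2 * (eta / N) * (t * N) = 2 * eta * t by field; lra.
  nra.
have epsf : (eps / N) ^ f <= (eps / eta) ^ d * (eta / N) ^ f.
  have -> : eps / N = eps / eta * (eta / N) by field; lra.
  rewrite Rpow_mult_distr; apply: Rmult_le_compat_r; first by apply: pw0; lra.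
  exact: Rle_pow.
have Mq : 2 ^ d * (eps / eta) ^ d = M ^ d * q ^ d.
  rewrite -!Rpow_mult_distr; congr (_ ^ _); rewrite /M; field; lra.
have y0 : 0 <= (eta / N) ^ f by apply: pw0; lra.
have qd0 : 0 <= q ^ d by apply: pw0; lra.
apply: (Rle_trans _ (q ^ d * (eta / N) ^ f * (exp (c * t / 4) * exp (- (c * t))))).
  apply: (Rle_trans _ (2 ^ d * (((eps / eta) ^ d * (eta / N) ^ f) * exp (- (c * t))))).
    apply: Rmult_le_compat_l; first by apply: pw0; lra.
    apply: Rmult_le_compat => //; apply: pw0; lra.
  have -> : 2 ^ d * (((eps / eta) ^ d * (eta / N) ^ f) * exp (- (c * t))) =
            (eta / N) ^ f * q ^ d * exp (- (c * t)) * M ^ d.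
    by rewrite -!Rmult_assoc Mq; ring.
  have := exp_pos (- (c * t)) => e0.
  have -> : q ^ d * (eta / N) ^ f * (exp (c * t / 4) * exp (- (c * t))) =
            (eta / N) ^ f * q ^ d * exp (- (c * t)) * exp (c * t / 4) by ring.
  apply: Rmult_le_compat_l => //; apply: Rmult_le_pos; last lra.
  exact: Rmult_le_pos.
have -> : exp (- (2 * ln N)) *
   (q ^ d * (1 - q) ^ s * ((eta / N) ^ f * (1 - eta / N) ^ (Nat.mul s n))) =
   q ^ d * (eta / N) ^ f *
   (exp (- (2 * ln N)) * ((1 - q) ^ s * (1 - eta / N) ^ (Nat.mul s n))) by ring.
apply: Rmult_le_compat_l; first exact: Rmult_le_pos.
rewrite qs; apply: (Rle_trans _ (exp (- (2 * ln N)) * (exp (- (c * t / 4)) * exp (- (c * t / 4))))).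
  rewrite -!exp_plus; apply: exp_le; lra.
apply: Rmult_le_compat_l; first by left; apply: exp_pos.
by apply: Rmult_le_compat_l => //; left; apply: exp_pos.
Qed.

Lemma RlebP (x y : R) : reflect (x <= y) (Defs.Rleb x y).
Proof. by rewrite /Defs.Rleb; case: Rle_dec => h; constructor. Qed.

End Estimates.

(** * The failure probability of expansion *)

Lemma gnp_weightE (n : nat) (p : R) (E : {set {set 'I_n}}) :
  gnp_weight p E = subset_weight (pairs n) p E.
Proof. by rewrite /gnp_weight /subset_weight !RpowE. Qed.

Section Complement.

Import GRing.Theory.
Local Open Scope ring_scope.

Lemma gnp_prob_compl (n : nat) (p : R) (A B : pred {set {set 'I_n}}) :
  (forall E, B E = ~~ A E) ->
  gnp_prob p A = 1 - \sum_(E : {set {set 'I_n}} | (E \subset pairs n) && B E)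
    subset_weight (pairs n) p E.
Proof.
move=> BA; rewrite -(sum_subset_weight (pairs n) p) (bigID A) /=.
under [X in _ = _ - X]eq_bigl => E do rewrite BA.
by rewrite addrK; apply: eq_bigr => E _; rewrite gnp_weightE.
Qed.

End Complement.

Section Assembly.

Import Order.TTheory GRing.Theory Num.Theory.
Local Open Scope R_scope.

(** With [rho] equal to n^{-2}, the sum over the [n] roots gives 1/n. *)
Lemma expansion_failure_le (n : nat) (G : {set {set 'I_n}}) (eps alpha q eta delta K : R) :
  0 < eps -> alpha < 1 -> 0 < q < 1 -> 0 < eta -> 0 < delta -> 0 < K ->
  connectedb G ->
  eps <= INR n -> 2 * eta <= INR n -> 1 < INR n ->
  (forall s m d f : nat,
      K * ln (INR n) <= INR s -> INR s <= alpha * INR n -> INR d <= delta * INR s ->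
      INR m = INR s * (INR n - INR s) -> Peano.le f d ->
      2 ^ d * ((eps / INR n) ^ f * (1 - eps / INR n / 2) ^ m) <=
      exp (- (2 * ln (INR n))) *
        (q ^ d * (1 - q) ^ s * ((eta / INR n) ^ f * (1 - eta / INR n) ^ (Nat.mul s n)))) ->
  Rabs (gnp_prob (eps / INR n) (expansion_event G delta K alpha) - 1) <= / INR n.
Proof.
move=> eps0 alpha1 q01 eta0 delta0 K0 Gc nE nH n1 ratio.
set N := INR n in nE nH n1 ratio *.
have N0 : 0 < N by lra.
pose ok (S : {set 'I_n}) := Defs.Rleb (K * ln N) (INR #|S|) && Defs.Rleb (INR #|S|) (alpha * N).
(* An integer count below delta |S| is at most this floor. *)
pose d (S : {set 'I_n}) := nat_floor (delta * INR #|S|).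
pose B := [pred E | ~~ expansion_event G delta K alpha E].
pose w : R := \big[Rplus/0]_(E : {set {set 'I_n}} | (E \subset pairs n) && B E)
  subset_weight (pairs n) (eps / N) E.
have -> : gnp_prob (eps / N) (expansion_event G delta K alpha) = 1 - w.
  exact: gnp_prob_compl.
have -> : 1 - w - 1 = - w by ring.
have le01 x : 0 <= x <= 1 -> (0%R <= x <= 1%R)%O.
  by case=> /RleP -> /RleP ->.
have divN x : 0 <= x <= N -> 0 <= x / N <= 1.
  move=> x0N; split; last by apply: (Rmult_le_reg_r N) => //; rewrite /Rdiv Rmult_assoc Rinv_l; lra.
  by apply: Rmult_le_pos; [lra | left; apply: Rinv_0_lt_compat].
have w0 : 0 <= w.
  apply/RleP; apply: sumr_ge0 => E _; apply: subset_weight_ge0.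
  by apply: le01; apply: divN; lra.
rewrite Rabs_Ropp Rabs_pos_eq //.
have rhoN : exp (- (2 * ln N)) * N = / N.
  rewrite -{2}(exp_ln N N0) -exp_plus -{3}(exp_ln N N0) -exp_Ropp; f_equal; ring.
rewrite -rhoN.
(* [K * ln N > 0] rules out the empty set and [alpha * N < N] the full one. *)
have okP S : ok S -> (S != set0) && (S != setT).
  case/andP=> /RlebP h1 /RlebP h2; apply/andP; split; apply/eqP=> eS.
    rewrite eS cards0 in h1.
    have : 0 < ln N by rewrite -ln_1; apply: ln_increasing; lra.
    move=> lnN; have := Rmult_lt_0_compat _ _ K0 lnN; rewrite /= in h1; lra.
  rewrite eS cardsT card_ord -/N in h2; nra.
apply: (Rle_trans _ (\big[Rplus/0]_(E : {set {set 'I_n}} |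
   (E \subset pairs n) && nonexpanding G ok d E)
   subset_weight (pairs n) (eps / N) E)).
  apply/RleP; rewrite /w big_mkcondr [leRHS]big_mkcondr.
  apply: ler_sum => E Ep /=.
  have wE : (0 <= subset_weight (pairs n) (eps / N) E)%O.
    by apply: subset_weight_ge0; apply: le01; apply: divN; lra.
  case: ifP => [bad|_]; last by case: ifP.
  suff -> : nonexpanding G ok d E by [].
  move: bad; rewrite /expansion_event negb_forall => /existsP[S]; rewrite negb_imply.
  case/andP=> /and3P[Sc h1 h2] h3; apply/existsP; exists S.
  apply/and3P; split=> //; first exact/andP.
  apply/ssrnat.leP; apply: nat_floor_max; move/RlebP: h3; lra.
have NE : N = GRing.natmul (GRing.one R) n by rewrite /N INRE.
rewrite [X in _ <= _ * X]NE.
apply/RleP.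
apply: (@nonexpanding_weight_le _ n G ok d (eps / N) q (eta / N) (exp (- (2 * ln N)))) => //.
- by apply: le01; apply: divN; lra.
- by apply: le01; lra.
- by apply: le01; apply: divN; lra.
- by apply/RleP; left; apply: exp_pos.
move=> S f okS fd; case/andP: (okS) => /RlebP h1 /RlebP h2; case/andP: (okP S okS) => _ ST.
have sn : (#|S| <= n)%nat by rewrite -[leqRHS]card_ord max_card.
have dS : INR (d S) <= delta * INR #|S|.
  by apply: nat_floor_le; apply: Rmult_le_pos; [lra | apply: pos_INR].
have mE : INR (#|S| * (n - #|S|)) = INR #|S| * (N - INR #|S|).
  by rewrite mult_INR minus_INR //; apply/ssrnat.leP.
have := ratio _ _ _ f h1 h2 dS mE (elimT ssrnat.leP fd).
rewrite !RpowE => le; apply/RleP; rewrite -RdivE.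
exact: le.
Qed.

End Assembly.

Theorem theorem3 :
  forall eps alpha : R, (0 < eps)%R -> (alpha < 1)%R ->
  exists delta K : R, (0 < delta)%R /\ (0 < K)%R /\
  forall G : forall n : nat, {set {set 'I_n}},
    (forall n, G n \subset pairs n) ->
    (forall n, connectedb (G n)) ->
    Un_cv (fun n => gnp_prob (eps / INR n)%R (expansion_event (G n) delta K alpha)) 1%R.
Proof.
move=> eps alpha eps0 alpha1.
have [q [eta [delta [K [q01 eta0 delta0 K0 ratio]]]]] := weight_ratio eps0 alpha1.
exists delta, K; split=> //; split=> // G _ Gc e e0.
(* Large enough for [eps / n <= 1], [eta / n <= 1 / 2], a positive [ln n] and [1 / n < e]. *)
have [k kB] := INR_unbounded (eps + 2 * eta + 1 + / e).
have ie0 : (0 < / e)%R by apply: Rinv_0_lt_compat.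
exists k => n kn; have nk := le_INR _ _ kn.
have nN : (eps + 2 * eta + 1 + / e < INR n)%R by lra.
apply: Rle_lt_trans (_ : (/ INR n < e)%R).
  apply: (expansion_failure_le eps0 alpha1 q01 eta0 delta0 K0 (Gc n)); try lra.
  by move=> s m d f; apply: ratio; lra.
by rewrite -[e]Rinv_inv; apply: Rinv_lt_contravar; [apply: Rmult_lt_0_compat; lra | lra].
Qed.
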